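(* Consider the folded hyper-Kähler metric $$g=Z(dX^2+dY^2+dZ^2)+\frac1Z\Big(dT+\tfrac12X\,dY-\tfrac12Y\,dX\Big)^2,$$ with $(X,Y,Z)\in\mathbb{R}^3$ and $T$ periodic with period $2\pi$, which degenerates on the fold $Z=0$. There exist normalisable solutions of the time-independent Schrödinger equation $$\frac{1}{\sqrt{|g|}}\,\partial_a\big(\sqrt{|g|}\,g^{ab}\,\partial_b\phi\big)=E\phi$$ which extend to both sides of the fold $Z=0$. In particular, let $s$ be a positive integer and let $E\in\mathbb{R}$ be such that $$\gamma=\frac{E^2}{8s^3}-1$$ is a positive integer. Then $$\phi=H_\gamma\Big(\sqrt{s}\big(Z+\tfrac{E}{2s^2}\big)\Big)\exp\Big\{-\tfrac12 s\big(Z+\tfrac{E}{2s^2}\big)^2\Big\}\exp\Big\{-\tfrac14 s(X^2+Y^2)\Big\}\exp\{isT\}$$ is a normalisable solution.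
   Context: $H_\gamma$ is the Hermite polynomial of degree $\gamma$, i.e. the polynomial solution of $H''(\xi)-2\xi H'(\xi)+2\gamma H(\xi)=0$. Across the fold the Schrödinger equation is understood as the equation (written out, valid for $Z\neq0$, with $\sqrt{|g|}=Z$ up to sign) $$\frac1Z\Big(\tfrac14(X^2+Y^2)+Z^2\Big)\partial_T^2\phi-\frac XZ\partial_Y\partial_T\phi+\frac YZ\partial_X\partial_T\phi+\frac1Z(\partial_X^2+\partial_Y^2+\partial_Z^2)\phi=E\phi .$$ A solution extends through the fold if it is smooth on all of $\{(T,X,Y,Z)\}$, including $Z=0$, and satisfies the equation on both $Z>0$ and $Z<0$. Normalisable means $\int|\phi|^2\,|Z|\,dT\,dX\,dY\,dZ<\infty$, with $T$ integrated over one period. *)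

(* Defs.v *)
From HB Require Import structures.
From mathcomp Require Import all_boot all_order all_algebra.
From mathcomp Require Import complex ring.
From mathcomp Require Import all_classical all_reals all_analysis.

Set Implicit Arguments.
Unset Strict Implicit.
Unset Printing Implicit Defensive.

Import Order.TTheory GRing.Theory Num.Theory.
Import numFieldNormedType.Exports.

Local Open Scope ring_scope.
Local Open Scope classical_set_scope.
Local Open Scope complex_scope.

(* Points are rows (T, X, Y, Z).  A function on S^1 x R^3 is represented by a
   function on R^4 that is 2 pi-periodic in its first coordinate. *)
Definition iT : 'I_4 := inord 0.
Definition iX : 'I_4 := inord 1.
Definition iY : 'I_4 := inord 2.
Definition iZ : 'I_4 := inord 3.

Definition coords (R : realType) (t x y z : R) : 'rV[R]_4 :=
  \row_(a < 4) nth 0 [:: t; x; y; z] a.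

Section Calculus.
Variable R : realType.
Implicit Types (f : 'rV[R]_4 -> R) (phi : 'rV[R]_4 -> R[i]) (a : 'I_4).

Definition unitvec a : 'rV[R]_4 := delta_mx 0 a.

(* R[i] carries no topology as a real vector space, hence the componentwise
   derivatives. *)
Definition pderiv a phi : 'rV[R]_4 -> R[i] := fun p =>
  'D_(unitvec a) (fun q => complex.Re (phi q)) p
  +i* 'D_(unitvec a) (fun q => complex.Im (phi q)) p.

Fixpoint Cn (n : nat) f : Prop :=
  continuous f /\
  if n is m.+1 then
    forall a, (forall p, derivable f p (unitvec a)) /\
              Cn m (fun p => 'D_(unitvec a) f p)
  else True.

Definition smooth phi : Prop :=
  forall n, Cn n (fun p => complex.Re (phi p)) /\ Cn n (fun p => complex.Im (phi p)).

End Calculus.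

Section Metric.
Variable R : realType.
Implicit Types (p : 'rV[R]_4) (phi : 'rV[R]_4 -> R[i]).

(* The components of dT + (1/2) X dY - (1/2) Y dX. *)
Definition connection p : 'rV[R]_4 :=
  coords 1 (- (p 0 iY / 2)) (p 0 iX / 2) 0.

Definition metric p : 'M[R]_4 :=
  p 0 iZ *: diag_mx (coords 0 1 1 1)
  + (p 0 iZ)^-1 *: ((connection p)^T *m connection p).

Definition sqrt_abs_det p : R := Num.sqrt `|\det (metric p)|.

Definition laplace_beltrami phi p : R[i] :=
  ((sqrt_abs_det p)^-1)%:C *
  \sum_(a < 4) pderiv a (fun q =>
     \sum_(b < 4)
       (sqrt_abs_det q * (invmx (metric q)) a b)%:C * pderiv b phi q) p.

(* laplace_beltrami multiplied out; the sign of sqrt|g| cancels, so the two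
   agree on smooth functions for Z <> 0 of either sign. *)
Definition expanded_operator phi p : R[i] :=
  let X := p 0 iX in let Y := p 0 iY in let Z := p 0 iZ in
  (Z^-1 * ((X ^+ 2 + Y ^+ 2) / 4 + Z ^+ 2))%:C * pderiv iT (pderiv iT phi) p
  - (X / Z)%:C * pderiv iY (pderiv iT phi) p
  + (Y / Z)%:C * pderiv iX (pderiv iT phi) p
  + (Z^-1)%:C * (pderiv iX (pderiv iX phi) p + pderiv iY (pderiv iY phi) p
                 + pderiv iZ (pderiv iZ phi) p).

Definition periodicT phi : Prop :=
  forall p, phi (p + (2 * pi) *: unitvec R iT) = phi p.

Definition spacetime_measure : set (R * R * R * R) -> \bar R :=
  (((@lebesgue_measure R \x @lebesgue_measure R)
      \x @lebesgue_measure R) \x @lebesgue_measure R)%E.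

Definition normalisable phi : Prop :=
  (\int[spacetime_measure]_(w in [set w | (0 <= w.1.1.1 <= 2 * pi)%R])
     (ComplexField.Normc.normc (phi (coords w.1.1.1 w.1.1.2 w.1.2 w.2)) ^+ 2
      * `|w.2|)%:E < +oo)%E.

Definition extends_through_fold (E : R) phi : Prop :=
  smooth phi /\
  forall p, p 0 iZ != 0 -> expanded_operator phi p = E%:C * phi p.

(* The zero function is excluded: its norm cannot be scaled to 1. *)
Definition normalisable_solution_through_fold (E : R) phi : Prop :=
  [/\ periodicT phi,
      exists p, phi p != 0,
      forall p, p 0 iZ != 0 -> laplace_beltrami phi p = E%:C * phi p,
      extends_through_fold E phi
    & normalisable phi].

(* This determines H up to a nonzero scalar, and no normalisation is fixed;
   is_hermite_physicists below shows that such an H exists for every n. *)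
Definition is_hermite (n : nat) (H : {poly R}) : Prop :=
  size H = n.+1 /\ deriv (deriv H) - (2 *: 'X) * deriv H + (2 * n%:R) *: H = 0.

Definition hermite_state (s : nat) (E : R) (H : {poly R}) : 'rV[R]_4 -> R[i] :=
  fun p =>
  let T := p 0 iT in let X := p 0 iX in let Y := p 0 iY in
  let zeta := p 0 iZ + E / (2 * s%:R ^+ 2) in
  (H.[Num.sqrt s%:R * zeta]
   * expR (- (2^-1 * s%:R * zeta ^+ 2))
   * expR (- (4^-1 * s%:R * (X ^+ 2 + Y ^+ 2))))%:C
  * (cos (s%:R * T) +i* sin (s%:R * T)).

End Metric.

Section HermiteExistence.
Variable R : realType.

Fixpoint physicists_hermite (n : nat) : {poly R} :=
  if n is m.+1 then
    (2 *: 'X) * physicists_hermite m - deriv (physicists_hermite m)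
  else 1.

Lemma deriv_physicists_hermite n :
  deriv (physicists_hermite n.+1) = (2 * n.+1%:R) *: physicists_hermite n.
Proof.
elim: n => [|n IH].
  by rewrite /= derivB derivM derivZ derivX derivC mulr0 addr0 mulr1 deriv0 subr0 mulr1.
have -> : physicists_hermite n.+2 =
  (2 *: 'X) * physicists_hermite n.+1 - deriv (physicists_hermite n.+1) by [].
rewrite derivB derivM derivZ derivX IH derivZ.
have E : physicists_hermite n.+1 =
  (2 *: 'X) * physicists_hermite n - deriv (physicists_hermite n) by [].
have -> : deriv (physicists_hermite n) =
  (2 *: 'X) * physicists_hermite n - physicists_hermite n.+1.
  by rewrite E opprB addrC subrK.
rewrite -!mul_polyC; set K := physicists_hermite n.+1.
set L := physicists_hermite n.
have -> : n.+2%:R = n.+1%:R + 1 :> R by rewrite -[n.+2]addn1 natrD.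
rewrite !polyCM !polyCD polyC1; ring.
Qed.

Lemma size_physicists_hermite n : size (physicists_hermite n) = n.+1.
Proof.
have two : (2 : R) != 0 by rewrite pnatr_eq0.
elim: n => [|n IH]; first by rewrite size_poly1.
have nz : physicists_hermite n != 0 by rewrite -size_poly_eq0 IH.
have S : size ((2 *: 'X) * physicists_hermite n) = n.+2.
  by rewrite -scalerAl size_scale // mulrC size_mulX // IH.
rewrite [physicists_hermite _]/= size_polyDl ?S // size_polyN.
by apply: ltn_trans (lt_size_deriv nz) _; rewrite IH.
Qed.

Lemma is_hermite_physicists n : is_hermite n (physicists_hermite n).
Proof.
split; first exact: size_physicists_hermite.
case: n => [|n].
  by rewrite /= !(derivC, deriv0) !(mulr0, scale0r, subr0, addr0).
have E : physicists_hermite n.+1 =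
  (2 *: 'X) * physicists_hermite n - deriv (physicists_hermite n) by [].
rewrite deriv_physicists_hermite derivZ E.
rewrite -!mul_polyC; ring.
Qed.

End HermiteExistence.

(* Main.v *)
Require Import Defs.
From HB Require Import structures.
From mathcomp Require Import all_boot all_order all_algebra.
From mathcomp Require Import complex ring lra.
From mathcomp Require Import all_classical all_reals all_analysis.
From mathcomp Require Import measurable_realfun.

Set Implicit Arguments.
Unset Strict Implicit.
Unset Printing Implicit Defensive.

Import Order.TTheory GRing.Theory Num.Theory.
Import numFieldNormedType.Exports.

Local Open Scope ring_scope.

(** Away from the fold the determinant of the metric is Z^2, and the matrix Z g^-1 is
    polynomial, with an a-th row that does not depend on the a-th coordinate. The
    divergence in the Laplace-Beltrami operator therefore passes through the
    coefficients, and on functions whose T-derivative commutes with the X- and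
    Y-derivatives the operator is the expanded one ([laplace_beltrami_flux],
    [laplace_beltrami_expanded]).

    The states have T-dependence exp(i s T), so that the second T-derivative is
    - s^2, and they are radial in (X, Y), so that the two mixed terms cancel. The
    lowest Landau-level Gaussian exp(- s (X^2 + Y^2) / 4) absorbs the potential
    s^2 (X^2 + Y^2) / 4 at the price of the constant s. In Z there remains a harmonic
    oscillator with the linear term E Z; completing the square shifts the centre to
    - E / (2 s^2), and the quantisation condition gamma + 1 = E^2 / (8 s^3) is the one
    for which the Hermite function of degree gamma solves it ([hermite_ladder],
    [state_eigen]).

    The formula for a state never mentions 1 / Z, hence it is smooth across Z = 0: it
    is built from coordinates by sums, products, exp, cos and sin, a class closed
    under differentiation ([elementary_Cn], [smooth_state]). Its squared modulus
    times |Z| is constant in T and a product of functions of X, Y and Z, each the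
    absolute value of a polynomial times a Gaussian; Tonelli's theorem and an
    integrable majorant for such functions give normalisability
    ([spacetime_integral_lty], [integral_poly_gauss_lty]). Existence
    follows from the case s = gamma = 1, E = 4. *)

(** * Derivatives along lines *)

Section LineDerivatives.
Context {R : realType} {V : normedModType R}.
Implicit Types (f g : V -> R) (p v : V).

(** A directional derivative is a one-variable derivative along the line through
    the point; this is how the one-variable chain rule is transferred below. *)
Lemma is_derive_line f p v (df : R) :
  is_derive p v f df <-> is_derive (0 : R) 1 (fun h : R => f (h *: v + p)) df.
Proof.
have E : 'D_v f p = 'D_1 (fun h : R => f (h *: v + p)) 0.
  rewrite /derive; set g1 := fun h => h^-1 *: _; set g2 := fun h => h^-1 *: _.
  suff -> : g1 = g2 by [].
  by apply/funext => h; rewrite /g1 /g2 /= addr0 scale0r add0r [_%:A]mulr1.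
split=> -[D <-].
- by rewrite E; apply: DeriveDef => //; exact: (derivable1P f p v).1.
- by rewrite -E; apply: DeriveDef => //; exact: (derivable1P f p v).2.
Qed.

Lemma is_derive_comp (h : R -> R) f p v (dh df : R) :
  is_derive (f p) 1 h dh -> is_derive p v f df ->
  is_derive p v (fun q => h (f q)) (dh * df).
Proof.
move=> Dh /is_derive_line Df; apply/is_derive_line.
by apply: (@is_derive1_comp _ h); rewrite ?scale0r ?add0r.
Qed.

Lemma is_derive_add f g p v (df dg : R) :
  is_derive p v f df -> is_derive p v g dg ->
  is_derive p v (fun q => f q + g q) (df + dg).
Proof. exact: is_deriveD. Qed.

Lemma is_derive_mul f g p v (df dg : R) :
  is_derive p v f df -> is_derive p v g dg ->
  is_derive p v (fun q => f q * g q) (df * g p + f p * dg).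
Proof.
move=> Df Dg; have := is_deriveM Df Dg.
by rewrite addrC [X in X + _]mulrC.
Qed.

End LineDerivatives.

Lemma is_derive_coord {R : realType} (p v : 'rV[R]_4) (b : 'I_4) :
  is_derive p v (fun q : 'rV[R]_4 => q 0 b) (v 0 b).
Proof.
apply/is_derive_line.
have -> : (fun h : R => (h *: v + p) 0 b) = (fun h => h * v 0 b + p 0 b).
  by apply/funext => h; rewrite !mxE.
have Dl : is_derive (0 : R) 1 (fun h : R => h * v 0 b) (v 0 b).
  have := @is_derive_mul R R id (fun=> v 0 b) 0 1 1 0 (is_derive_id _ _)
    (is_derive_cst _ _ _).
  by rewrite mulr0 addr0 mul1r.
have Dc : is_derive (0 : R) (1 : R) (fun=> p 0 b) 0 by exact: is_derive_cst.
have := @is_derive_add R R _ _ _ _ _ _ Dl Dc.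
by rewrite addr0.
Qed.

(** * A class of smooth functions *)

Section Elementary.
Variable R : realType.
Implicit Types f g : 'rV[R]_4 -> R.

(** The class is closed under directional derivatives, so that membership gives
    derivatives of all orders at once, without computing any of them. *)
Inductive elementary : ('rV[R]_4 -> R) -> Prop :=
| elementary_const c : elementary (fun=> c)
| elementary_coord b : elementary (fun p => p 0 b)
| elementary_add f g :
    elementary f -> elementary g -> elementary (fun p => f p + g p)
| elementary_mul f g :
    elementary f -> elementary g -> elementary (fun p => f p * g p)
| elementary_exp f : elementary f -> elementary (fun p => expR (f p))
| elementary_cos f : elementary f -> elementary (fun p => cos (f p))
| elementary_sin f : elementary f -> elementary (fun p => sin (f p)).

Lemma elementary_continuous f : elementary f -> continuous f.
Proof.
elim=> [c|b|{}f g _ cf _ cg|{}f g _ cf _ cg|{}f _ cf|{}f _ cf|{}f _ cf] p.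
- exact: cst_continuous.
- exact: coord_continuous.
- exact: (cvgD (cf p) (cg p)).
- exact: (cvgM (cf p) (cg p)).
- by apply: continuous_comp; [exact: cf|exact: continuous_expR].
- by apply: continuous_comp; [exact: cf|exact: continuous_cos].
- by apply: continuous_comp; [exact: cf|exact: continuous_sin].
Qed.

Lemma elementary_derive f v : elementary f ->
  exists2 df, elementary df & forall p, is_derive p v f (df p).
Proof.
elim=> [c|b|{}f g ef [df edf Df] eg [dg edg Dg]
       |{}f g ef [df edf Df] eg [dg edg Dg]
       |{}f ef [df edf Df]|{}f ef [df edf Df]|{}f ef [df edf Df]].
- by exists (fun=> 0) => [|p]; [exact: elementary_const|exact: is_derive_cst].
- exists (fun=> v 0 b) => [|p]; first exact: elementary_const.
  exact: is_derive_coord.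
- exists (fun p => df p + dg p) => [|p]; first exact: elementary_add.
  exact: is_derive_add.
- exists (fun p => df p * g p + f p * dg p) => [|p].
    by apply: elementary_add; exact: elementary_mul.
  exact: is_derive_mul.
- exists (fun p => expR (f p) * df p) => [|p].
    by apply: elementary_mul => //; exact: elementary_exp.
  exact: is_derive_comp.
- exists (fun p => -1 * sin (f p) * df p) => [|p].
    apply: elementary_mul => //; apply: elementary_mul; last exact: elementary_sin.
    exact: elementary_const.
  by apply: is_derive_comp => //; rewrite mulN1r; exact: is_derive_cos.
- exists (fun p => cos (f p) * df p) => [|p].
    by apply: elementary_mul => //; exact: elementary_cos.
  exact: is_derive_comp.
Qed.

Lemma elementary_Cn n f : elementary f -> Cn n f.
Proof.
elim: n f => [|n IH] f ef; split=> //; try exact: elementary_continuous.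
move=> a; have [df edf Df] := elementary_derive (unitvec R a) ef.
split=> [p|]; first by have [] := Df p.
suff -> : (fun p => 'D_(unitvec R a) f p) = df by exact: IH.
by apply/funext => p; have [] := Df p.
Qed.

Lemma elementary_horner (P : {poly R}) f :
  elementary f -> elementary (fun p => P.[f p]).
Proof.
move=> ef; elim/poly_ind: P => [|P c IH].
  have -> : (fun p => (0 : {poly R}).[f p]) = fun=> 0.
    by apply/funext => p; rewrite horner0.
  exact: elementary_const.
have -> : (fun p => (P * 'X + c%:P).[f p]) = fun p => P.[f p] * f p + c.
  by apply/funext => p; rewrite !hornerE.
apply: elementary_add; last exact: elementary_const.
exact: elementary_mul.
Qed.

End Elementary.

(** * The four coordinate directions *)

Section FourDirections.

Lemma ord4_ind (P : 'I_4 -> Prop) : P iT -> P iX -> P iY -> P iZ -> forall a, P a.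
Proof.
move=> PT PX PY PZ [[|[|[|[|//]]]] lt_a]; move: PT PX PY PZ; rewrite /iT /iX /iY /iZ.
- by move=> H _ _ _; congr (P _): H; apply: val_inj; rewrite /= inordK.
- by move=> _ H _ _; congr (P _): H; apply: val_inj; rewrite /= inordK.
- by move=> _ _ H _; congr (P _): H; apply: val_inj; rewrite /= inordK.
- by move=> _ _ _ H; congr (P _): H; apply: val_inj; rewrite /= inordK.
Qed.

Lemma eq_dir : ((iT == iX) = false) * ((iT == iY) = false) * ((iT == iZ) = false) *
  ((iX == iT) = false) * ((iX == iY) = false) * ((iX == iZ) = false) *
  ((iY == iT) = false) * ((iY == iX) = false) * ((iY == iZ) = false) *
  ((iZ == iT) = false) * ((iZ == iX) = false) * ((iZ == iY) = false).
Proof. by do ![split]; rewrite -val_eqE /= !inordK. Qed.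

Lemma sum4 (V : nmodType) (F : 'I_4 -> V) :
  \sum_(a < 4) F a = F iT + F iX + F iY + F iZ.
Proof.
rewrite !big_ord_recr big_ord0 /= add0r.
by congr (F _ + F _ + F _ + F _); apply: val_inj; rewrite /= inordK.
Qed.

Lemma prod4 (V : comPzRingType) (F : 'I_4 -> V) :
  \prod_(a < 4) F a = F iT * F iX * F iY * F iZ.
Proof.
rewrite !big_ord_recr big_ord0 /= mul1r.
by congr (F _ * F _ * F _ * F _); apply: val_inj; rewrite /= inordK.
Qed.

Lemma coordsE (R : realType) (t x y z : R) : (coords t x y z 0 iT = t) *
  (coords t x y z 0 iX = x) * (coords t x y z 0 iY = y) * (coords t x y z 0 iZ = z).
Proof. by do ![split]; rewrite mxE inordK. Qed.

End FourDirections.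

(** * The metric away from the fold *)

Section Metric.
Variable R : realType.
Implicit Types q : 'rV[R]_4.

(** The matrix Z g^-1, which is polynomial in the coordinates and hence regular
    across the fold. *)
Definition flux_mx q : 'M[R]_4 :=
  let X := q 0 iX in let Y := q 0 iY in let Z := q 0 iZ in
  \matrix_(a, b)
    if a == iT then
      coords ((X ^+ 2 + Y ^+ 2) / 4 + Z ^+ 2) (Y / 2) (- (X / 2)) 0 0 b
    else if b == iT then coords 0 (Y / 2) (- (X / 2)) 0 0 a else (a == b)%:R.

Lemma metric_mul_flux q : q 0 iZ != 0 ->
  metric q *m ((q 0 iZ)^-1 *: flux_mx q) = 1%:M.
Proof.
move=> Z0; apply/matrixP => a b.
rewrite /metric /connection mxE sum4 !mxE !big_ord1 !mxE -!/iT.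
elim/ord4_ind: a; elim/ord4_ind: b;
  rewrite ?eqxx ?eq_dir ?coordsE /= /iT /iX /iY /iZ ?inordK //=;
  rewrite -/iT -/iX -/iY -/iZ ?mulr1n ?mulr0n; by field.
Qed.

(** In the coframe (dT + (X dY - Y dX)/2, dX, dY, dZ) the metric is diagonal with
    entries 1/Z, Z, Z, Z, and the change of coframe is unitriangular. *)
Lemma det_metric q : q 0 iZ != 0 -> \det (metric q) = q 0 iZ ^+ 2.
Proof.
move=> Z0.
pose P : 'M[R]_4 := \matrix_(a, b) if a == iT then connection q 0 b else (a == b)%:R.
pose d := coords (q 0 iZ)^-1 (q 0 iZ) (q 0 iZ) (q 0 iZ).
have detP : \det P = 1.
  rewrite -det_tr det_trig.
    by rewrite prod4 !mxE ?eqxx ?eq_dir /= /iT inordK //= !mulr1.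
  apply/is_trig_mxP => a b; elim/ord4_ind: a; elim/ord4_ind: b;
    rewrite !mxE ?eqxx ?eq_dir //; by rewrite !inordK.
have -> : metric q = P^T *m diag_mx d *m P.
  apply/matrixP => a b.
  rewrite /metric /connection !mxE big_ord1 !mxE /= sum4 !mxE !sum4 !mxE /d /P.
  elim/ord4_ind: a; elim/ord4_ind: b;
    rewrite ?eqxx ?eq_dir ?coordsE /= /connection /iT /iX /iY /iZ ?inordK //=;
    rewrite -/iT -/iX -/iY -/iZ ?mulr1n ?mulr0n; by field.
rewrite !det_mulmx det_tr detP det_diag prod4 !coordsE mul1r mulr1.
by field.
Qed.

Lemma sqrt_abs_detE q : q 0 iZ != 0 -> sqrt_abs_det q = `|q 0 iZ|.
Proof.
by move=> Z0; rewrite /sqrt_abs_det det_metric // normrX sqrtr_sqr normr_id.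
Qed.

Lemma invmx_metric q : q 0 iZ != 0 ->
  invmx (metric q) = (q 0 iZ)^-1 *: flux_mx q.
Proof.
move=> Z0; have gN := metric_mul_flux Z0.
have [gU _] := mulmx1_unit gN.
by rewrite -[LHS]mulmx1 -gN mulKmx.
Qed.

(** The volume factor |Z| turns g^-1 into a polynomial matrix times the sign of
    Z, which is locally constant off the fold. *)
Lemma metric_flux q a b : q 0 iZ != 0 ->
  sqrt_abs_det q * invmx (metric q) a b = Num.sg (q 0 iZ) * flux_mx q a b.
Proof.
move=> Z0; rewrite sqrt_abs_detE // invmx_metric // mxE normrEsg.
by field.
Qed.

End Metric.

(** * Partial derivatives of complex functions *)

Section ComplexDerivatives.
Local Open Scope complex_scope.
Variable R : realType.
Implicit Types (phi psi : 'rV[R]_4 -> R[i]) (p : 'rV[R]_4) (d e : R[i]).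

(** Existence of both real partial derivatives together with their value: the
    operator [pderiv] alone says nothing when they fail to exist. *)
Definition has_pderiv a phi p d : Prop :=
  is_derive p (unitvec R a) (fun q => complex.Re (phi q)) (complex.Re d) /\
  is_derive p (unitvec R a) (fun q => complex.Im (phi q)) (complex.Im d).

Lemma has_pderivE a phi p d : has_pderiv a phi p d -> pderiv a phi p = d.
Proof. by case=> -[_ re] [_ im]; rewrite /pderiv re im; case: d {re im}. Qed.

Lemma ReM (z w : R[i]) : complex.Re (z * w) =
  complex.Re z * complex.Re w + - complex.Im z * complex.Im w.
Proof. by case: z w => a b [c d] /=; rewrite mulNr. Qed.

Lemma ImM (z w : R[i]) : complex.Im (z * w) =
  complex.Re z * complex.Im w + complex.Im z * complex.Re w.
Proof. by case: z w => a b [c d]. Qed.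

Lemma has_pderiv_mul a phi psi p d e :
  has_pderiv a phi p d -> has_pderiv a psi p e ->
  has_pderiv a (fun q => phi q * psi q) p (d * psi p + phi p * e).
Proof.
move=> [re1 im1] [re2 im2]; split.
- under [X in is_derive _ _ X _]funext => q do rewrite ReM.
  have im1N : is_derive p (unitvec R a) (fun q => - complex.Im (phi q)) (- complex.Im d).
    exact: is_deriveN.
  apply: is_derive_eq (is_derive_add (is_derive_mul re1 re2) (is_derive_mul im1N im2)) _.
  by rewrite raddfD /= !ReM; ring.
- under [X in is_derive _ _ X _]funext => q do rewrite ImM.
  apply: is_derive_eq (is_derive_add (is_derive_mul re1 im2) (is_derive_mul im1 re2)) _.
  by rewrite raddfD /= !ImM; ring.
Qed.

Lemma has_pderiv_sum n (F : 'I_n -> 'rV[R]_4 -> R[i]) (d : 'I_n -> R[i]) a p :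
  (forall b, has_pderiv a (F b) p (d b)) ->
  has_pderiv a (fun q => \sum_b F b q) p (\sum_b d b).
Proof.
move=> D; split.
- have := is_derive_sum (fun b => (D b).1); rewrite raddf_sum.
  by congr is_derive; apply/funext => q; rewrite fct_sumE raddf_sum.
- have := is_derive_sum (fun b => (D b).2); rewrite raddf_sum.
  by congr is_derive; apply/funext => q; rewrite fct_sumE raddf_sum.
Qed.

Lemma has_pderiv_real a (k : 'rV[R]_4 -> R) p (dk : R) :
  is_derive p (unitvec R a) k dk -> has_pderiv a (fun q => (k q)%:C) p dk%:C.
Proof. by move=> Dk; split=> //=; exact: is_derive_cst. Qed.

Lemma has_pderiv_cst a (c : R[i]) p : has_pderiv a (fun=> c) p 0.
Proof. by split; exact: is_derive_cst. Qed.

Lemma smooth_has_pderiv phi a p : smooth phi -> has_pderiv a phi p (pderiv a phi p).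
Proof.
move=> /(_ 1%N) [[_ re] [_ im]]; split; apply: derivableP.
- exact: (re a).1.
- exact: (im a).1.
Qed.

Lemma smooth_pderiv phi a : smooth phi -> smooth (pderiv a phi).
Proof.
move=> sm n; have [[_ re] [_ im]] := sm n.+1; split.
- exact: (re a).2.
- exact: (im a).2.
Qed.

Lemma pderiv_mul a (k : 'rV[R]_4 -> R) (dk : R) phi p :
  is_derive p (unitvec R a) k dk -> smooth phi ->
  pderiv a (fun q => (k q)%:C * phi q) p = dk%:C * phi p + (k p)%:C * pderiv a phi p.
Proof.
move=> Dk sm; apply: has_pderivE.
exact: has_pderiv_mul (has_pderiv_real Dk) (smooth_has_pderiv a p sm).
Qed.

Lemma pderiv_mulc a (z : R[i]) phi p : smooth phi ->
  pderiv a (fun q => z * phi q) p = z * pderiv a phi p.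
Proof.
move=> sm; apply: has_pderivE.
have := has_pderiv_mul (has_pderiv_cst a z p) (smooth_has_pderiv a p sm).
by rewrite mul0r add0r.
Qed.

Lemma near_pderiv a phi psi p :
  (\near p, phi p = psi p) -> pderiv a phi p = pderiv a psi p.
Proof.
move=> eqp; rewrite /pderiv; congr (_ +i* _); apply: near_eq_derive;
  by apply: filterS eqp => q ->.
Qed.

Lemma is_derive_invariant (f : 'rV[R]_4 -> R) p v :
  (forall h : R, f (h *: v + p) = f p) -> is_derive p v f 0.
Proof.
move=> inv; apply/is_derive_line.
under [X in is_derive _ _ X _]funext => h do rewrite inv.
exact: is_derive_cst.
Qed.

End ComplexDerivatives.

(** * The Laplace-Beltrami operator *)

Section LaplaceBeltrami.
Local Open Scope complex_scope.
Variable R : realType.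
Implicit Types (phi : 'rV[R]_4 -> R[i]) (p : 'rV[R]_4).

(** The a-th row of Z g^-1 does not depend on the a-th coordinate, so the divergence
    in the Laplace-Beltrami operator never differentiates the coefficients. *)
Lemma flux_mx_derive p a b :
  is_derive p (unitvec R a) (fun q => flux_mx q a b) 0.
Proof.
apply: is_derive_invariant => h.
elim/ord4_ind: a; elim/ord4_ind: b; rewrite !mxE ?eqxx ?eq_dir //= ?mulr0 ?add0r //.
- by rewrite /iX !inordK.
- by rewrite /iY !inordK.
Qed.

Lemma near_sg_coord p a : p 0 a != 0 ->
  \forall q \near p, Num.sg ((q : 'rV[R]_4) 0 a) = Num.sg (p 0 a) /\ q 0 a != 0.
Proof.
have ca : ((fun q : 'rV[R]_4 => q 0 a) @ p --> p 0 a)%classic by exact: coord_continuous.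
rewrite neq_lt => /orP[neg|pos].
- near=> q; have qa : q 0 a < 0 by near: q; exact: cvgr_lt ca _ neg.
  by rewrite !ltr0_sg // lt_eqF.
- near=> q; have qa : 0 < q 0 a by near: q; exact: cvgr_gt ca _ pos.
  by rewrite !gtr0_sg // gt_eqF.
Unshelve. all: by end_near. Qed.

Lemma laplace_beltrami_flux phi p : smooth phi -> p 0 iZ != 0 ->
  laplace_beltrami phi p = ((p 0 iZ)^-1)%:C *
    \sum_(a < 4) \sum_(b < 4) (flux_mx p a b)%:C * pderiv a (pderiv b phi) p.
Proof.
move=> sm Z0.
have flux a : pderiv a (fun q => \sum_(b < 4)
      (sqrt_abs_det q * (invmx (metric q)) a b)%:C * pderiv b phi q) p =
    (Num.sg (p 0 iZ))%:C * \sum_(b < 4) (flux_mx p a b)%:C * pderiv a (pderiv b phi) p.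
  rewrite (@near_pderiv _ _ _ (fun q => (Num.sg (p 0 iZ))%:C *
      \sum_(b < 4) (flux_mx q a b)%:C * pderiv b phi q)); last first.
    apply: filterS (near_sg_coord Z0) => q [sgq q0].
    rewrite mulr_sumr; apply: eq_bigr => b _.
    by rewrite metric_flux // sgq rmorphM mulrA.
  apply: has_pderivE.
  have := has_pderiv_mul (has_pderiv_cst a (Num.sg (p 0 iZ))%:C p)
    (has_pderiv_sum (fun b => has_pderiv_mul (has_pderiv_real (flux_mx_derive p a b))
       (smooth_has_pderiv a p (smooth_pderiv b sm)))).
  rewrite mul0r add0r; congr (has_pderiv _ _ _ (_ * _)).
  by apply: eq_bigr => b _; rewrite mul0r add0r.
rewrite /laplace_beltrami; under eq_bigr => a _ do rewrite flux.
rewrite -mulr_sumr mulrA -rmorphM sqrt_abs_detE //; congr (_%:C * _).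
by rewrite normrEsg invfM mulrAC invr_sg -expr2 sqr_sg Z0 mul1r.
Qed.

Lemma flux_mx_sum (F : 'I_4 -> 'I_4 -> R[i]) p :
  \sum_(a < 4) \sum_(b < 4) (flux_mx p a b)%:C * F a b =
  ((p 0 iX ^+ 2 + p 0 iY ^+ 2) / 4 + p 0 iZ ^+ 2)%:C * F iT iT
  + (p 0 iY / 2)%:C * (F iT iX + F iX iT) - (p 0 iX / 2)%:C * (F iT iY + F iY iT)
  + F iX iX + F iY iY + F iZ iZ.
Proof.
rewrite !sum4 !mxE !eqxx !eq_dir /= /iT /iX /iY /iZ !inordK //= -/iT -/iX -/iY -/iZ.
rewrite !rmorphN /= !rmorph0 !rmorph1; ring.
Qed.

(** The off-diagonal entries of Z g^-1 pair T with X and with Y, and each occurs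
    twice; commuting the derivatives merges the two occurrences and cancels the
    factor 1/2 of the connection. *)
Lemma laplace_beltrami_expanded phi p : smooth phi -> p 0 iZ != 0 ->
  pderiv iT (pderiv iX phi) p = pderiv iX (pderiv iT phi) p ->
  pderiv iT (pderiv iY phi) p = pderiv iY (pderiv iT phi) p ->
  laplace_beltrami phi p = expanded_operator phi p.
Proof.
move=> sm Z0.
rewrite (laplace_beltrami_flux sm Z0) flux_mx_sum /expanded_operator.
(* With [pderiv] and the directions abstracted, only an identity that is linear
   in the second derivatives is left. *)
move: Z0; move: (@pderiv R) iT iX iY iZ => D a b c d Z0 -> ->.
move: (D a _ p) (D b (D a phi) p) (D c (D a phi) p) (D b (D b phi) p)
  (D c (D c phi) p) (D d (D d phi) p)
  => [t t'] [u u'] [v v'] [x x'] [y y'] [z z'].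
move: (p 0 b) (p 0 c) (p 0 d) Z0 => X Y Z Z0.
by apply/eqP; rewrite eq_complex /=; apply/andP; split; apply/eqP; field.
Qed.

End LaplaceBeltrami.

(** * Integrals of products on spacetime *)

Section Tonelli.
Local Open Scope ereal_scope.

(** Tonelli's theorem is iterated, so the product measure has to carry its
    sigma-finiteness along. *)
Definition sigma_finite_prod d1 d2 (T1 : measurableType d1) (T2 : measurableType d2)
    (R : realType) (m1 : {sigma_finite_measure set T1 -> \bar R})
    (m2 : {sigma_finite_measure set T2 -> \bar R}) :
    {sigma_finite_measure set (T1 * T2)%type -> \bar R} :=
  let sfinite :=
    lebesgue_integral_fubini.measure_function_Measure_isSigmaFinite__to__measure_function_isSFinite m1 m2 in
  let sigma_finite :=
    lebesgue_integral_fubini.measure_function_Measure_isSigmaFinite__to__measure_function_isSigmaFinite m1 m2 in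
  HB.pack (m1 \x m2) sfinite sigma_finite.

Lemma integral_prod_lty d1 d2 (T1 : measurableType d1) (T2 : measurableType d2)
    (R : realType) (m1 : {sigma_finite_measure set T1 -> \bar R})
    (m2 : {sigma_finite_measure set T2 -> \bar R}) (f : T1 -> R) (g : T2 -> R) :
  measurable_fun [set: T1] f -> measurable_fun [set: T2] g ->
  (forall x, 0 <= f x)%R -> (forall y, 0 <= g y)%R ->
  \int[m1]_x (f x)%:E < +oo -> \int[m2]_y (g y)%:E < +oo ->
  \int[m1 \x m2]_w (f w.1 * g w.2)%:E < +oo.
Proof.
move=> mf mg f0 g0 If Ig.
rewrite fubini_tonelli1; last 2 first.
- by apply/measurable_EFinP; apply: measurable_funM; apply: measurableT_comp.
- by move=> w; rewrite lee_fin mulr_ge0.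
rewrite /fubini_F /=.
under eq_integral => x _.
  under eq_integral => y _ do rewrite EFinM.
  rewrite ge0_integralZl_EFin //; last 2 first.
  - by move=> y _; rewrite lee_fin.
  - exact/measurable_EFinP.
  over.
rewrite ge0_integralZr //; last 3 first.
- exact/measurable_EFinP.
- by move=> x _; rewrite lee_fin.
- by apply: integral_ge0 => y _; rewrite lee_fin.
rewrite lte_mul_pinfty //.
- by apply: integral_ge0 => y _; rewrite lee_fin.
- rewrite ge0_fin_numE //.
  by apply: integral_ge0 => y _; rewrite lee_fin.
Qed.

(** The integrand is a product of functions of one coordinate each, the indicator
    of [0, b] being the factor that depends on T, and Tonelli's theorem applies three
    times. *)
Lemma spacetime_integral_lty (R : realType) (b : R) (f g h : R -> R) :
  measurable_fun [set: R] f -> measurable_fun [set: R] g ->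
  measurable_fun [set: R] h ->
  (forall x, 0 <= f x)%R -> (forall x, 0 <= g x)%R -> (forall x, 0 <= h x)%R ->
  \int[@lebesgue_measure R]_x (f x)%:E < +oo ->
  \int[@lebesgue_measure R]_x (g x)%:E < +oo ->
  \int[@lebesgue_measure R]_x (h x)%:E < +oo ->
  \int[@spacetime_measure R]_(w in [set w | (0 <= w.1.1.1 <= b)%R])
    (f w.1.1.2 * g w.1.2 * h w.2)%:E < +oo.
Proof.
move=> mf mg mh f0 g0 h0 fI gI hI.
pose L := measurableTypeR R.
pose leb : {sigma_finite_measure set L -> \bar R} := @lebesgue_measure R.
pose mu2 := sigma_finite_prod leb leb.
pose mu3 := sigma_finite_prod mu2 leb.
pose mu := mu3 \x leb.
(* The integral is taken for the product of the standard measurable structures of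
   R, while the measure lives on the product of the sigma-algebras generated by
   intervals: the measurable sets are the same, and the identity map i transports
   the integral from one structure to the other. *)
pose i : L * L * L * L -> R * R * R * R := id.
have mi : measurable_fun [set: L * L * L * L] i by move=> _ A mA; rewrite setTI.
pose I : R -> R := \1_(`[0%R, b]%classic).
have mI : measurable_fun [set: R] I by exact: measurable_indic.
have I0 x : (0 <= I x)%R by rewrite /I indicE.
have II : \int[leb]_x (I x)%:E < +oo.
  rewrite integral_indic // setIT /= lebesgue_measure_itv /=.
  by case: ifP => _; rewrite ?ltry.
have m3 : measurable_fun [set: R * R * R * R]
    (fun w : R * R * R * R => f w.1.1.2 * g w.1.2 * h w.2)%R.
  apply: measurable_funM; first apply: measurable_funM.
  - apply: measurableT_comp => //; apply: measurableT_comp => //.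
    exact: measurableT_comp.
  - by apply: measurableT_comp => //; apply: measurableT_comp.
  - exact: measurableT_comp.
have mD : measurable [set w : R * R * R * R | (0 <= w.1.1.1 <= b)%R].
  have m1 : measurable_fun [set: R * R * R * R] (fun w : R * R * R * R => w.1.1.1).
    by apply: measurableT_comp => //; exact: measurableT_comp.
  have := m1 measurableT `[0%R, b]%classic (measurable_itv _).
  by rewrite setTI; congr measurable; apply/seteqP; split=> w /=; rewrite in_itv.
have -> : \int[@spacetime_measure R]_(w in [set w | (0 <= w.1.1.1 <= b)%R])
    (f w.1.1.2 * g w.1.2 * h w.2)%:E =
  \int[pushforward mu i]_(w in [set w | (0 <= w.1.1.1 <= b)%R])
    (f w.1.1.2 * g w.1.2 * h w.2)%:E by [].
rewrite ge0_integral_pushforward //; last 2 first.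
- by apply/measurable_EFinP; apply: measurable_funTS.
- by move=> w _; rewrite lee_fin !mulr_ge0.
rewrite integral_mkcond.
rewrite (eq_integral (fun w : L * L * L * L =>
  ((I w.1.1.1 * f w.1.1.2 * g w.1.2) * h w.2)%:E)); last first.
  move=> w _; rewrite patchE /I indicE.
  have -> : (w.1.1.1 \in `[0%R, b]%classic) = (0 <= w.1.1.1 <= b)%R.
    by rewrite mem_setE in_itv.
  case: ifPn => [/set_mem /= ->|wD]; first by rewrite /= mul1r.
  have /negbTE -> : ~~ (0 <= w.1.1.1 <= b)%R.
    by apply: contra wD => wD; apply/mem_set.
  by rewrite !mul0r.
have mIf : measurable_fun [set: L * L] (fun v => I v.1 * f v.2)%R.
  by apply: measurable_funM; apply: measurableT_comp.
have mIfg : measurable_fun [set: L * L * L] (fun v => I v.1.1 * f v.1.2 * g v.2)%R.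
  apply: measurable_funM; last exact: measurableT_comp.
  exact: (@measurableT_comp _ _ _ _ _ _ _ _ _ mIf).
apply: (@integral_prod_lty _ _ _ _ _ mu3 leb
  (fun v => I v.1.1 * f v.1.2 * g v.2)%R h) => //.
  by move=> v; rewrite !mulr_ge0.
apply: (@integral_prod_lty _ _ _ _ _ mu2 leb (fun v => I v.1 * f v.2)%R g) => //.
  by move=> v; rewrite mulr_ge0.
exact: (@integral_prod_lty _ _ _ _ _ leb leb I f).
Qed.

(** Up to a constant factor this density is the integrable majorant of every
    polynomial times a Gaussian. *)
Lemma integral_oneDsqr_lty (R : realType) :
  \int[@lebesgue_measure R]_x ((oneDsqr x)^-1)%R%:E < +oo.
Proof.
have p0 x : (0 <= (oneDsqr x)^-1 :> R)%R.
  by rewrite invr_ge0 (le_trans ler01) ?oneDsqr_ge1.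
rewrite (ge0_symfun_integralT p0 (@continuous_oneDsqrV R)).
  by rewrite -set_itvcy integral0y_oneDsqr -EFinM ltry.
by move=> x /=; rewrite /oneDsqr sqrrN.
Qed.

End Tonelli.

(** * Polynomials against a Gaussian *)

Section GaussianMoments.
Context {R : realType}.
Implicit Types (P : {poly R}) (a c M x : R).

(** By induction on the degree: half of the exponent pays for the polynomial
    without its last Horner step, the other half for the factor x. *)
Lemma poly_le_gauss P a c : 0 < a ->
  exists2 M, 0 <= M & forall x, `|P.[x]| <= M * expR (a * (x + c) ^+ 2).
Proof.
elim/poly_ind: P a => [|P k IH] a a0.
  by exists 0 => // x; rewrite horner0 normr0 mul0r.
have b0 : 0 < a / 2 by rewrite divr_gt0.
have [M M0 PM] := IH _ b0.
exists (M * (1 + `|c| + (a / 2)^-1) + `|k|) => [|x].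
  by rewrite addr_ge0 // mulr_ge0 // !addr_ge0 // invr_ge0 ltW.
have e1 : 1 <= expR (a * (x + c) ^+ 2).
  by rewrite -expR0 ler_expR mulr_ge0 ?sqr_ge0 // ltW.
rewrite hornerMXaddC mulrDl (le_trans (ler_normD _ _)) //.
apply: lerD; last by rewrite ler_peMr.
rewrite normrM.
have -> : a * (x + c) ^+ 2 = a / 2 * (x + c) ^+ 2 + a / 2 * (x + c) ^+ 2 by field.
rewrite expRD mulrACA.
rewrite ler_pM //.
set u := (x + c) ^+ 2; set e := expR _.
have u0 : 0 <= u by exact: sqr_ge0.
have ue : 1 + a / 2 * u <= e by exact: expR_ge1Dx.
(* From |v| <= 1 + v^2 with v = x + c. *)
have xu : `|x| <= 1 + `|c| + u.
  have -> : x = (x + c) - c by rewrite addrK.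
  apply: le_trans (ler_normB _ _) _.
  rewrite addrAC lerD2r /u -real_normK ?num_real //.
  have := sqr_ge0 (`|x + c| - 1 / 2); nra.
apply: le_trans xu _.
have i0 : 0 < (a / 2)^-1 by rewrite invr_gt0.
have ui : u = (a / 2)^-1 * (a / 2 * u) by field; lra.
have e1' : 1 <= e by apply: le_trans ue; rewrite lerDl mulr_ge0 // ltW.
rewrite mulrDl lerD //; first by rewrite ler_peMr // addr_ge0.
rewrite {1}ui ler_pM2l //; lra.
Qed.

Definition poly_gauss P a c x : R := `|P.[x]| * expR (- (a * (x + c) ^+ 2)).

Lemma poly_gauss_ge0 P a c x : 0 <= poly_gauss P a c x.
Proof. by rewrite mulr_ge0 ?expR_ge0. Qed.

Lemma measurable_poly_gauss P a c : measurable_fun [set: R] (poly_gauss P a c).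
Proof.
apply: measurable_funM; apply: continuous_measurable_fun => x.
- by apply: cvg_norm; exact: continuous_horner.
- have -> : (fun y => expR (- (a * (y + c) ^+ 2)))
    = expR \o horner (- (a *: ('X + c%:P) ^+ 2)).
    by apply/funext => y /=; rewrite hornerN hornerZ horner_exp hornerD hornerX hornerC.
  apply: continuous_comp; [exact: continuous_horner|exact: continuous_expR].
Qed.

Lemma integral_poly_gauss_lty P a c : 0 < a ->
  (\int[@lebesgue_measure R]_x (poly_gauss P a c x)%:E < +oo)%E.
Proof.
move=> a0.
(* The extra factor 1 + x^2 leaves room for the integrable density 1 / (1 + x^2). *)
have [M M0 PM] := poly_le_gauss (P * (1 + 'X^2)) c a0.
have leM x : poly_gauss P a c x <= M * (oneDsqr x)^-1.
  have d0 : 0 < oneDsqr x by apply: lt_le_trans (oneDsqr_ge1 x).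
  rewrite /poly_gauss ler_pdivlMr // expRN mulrAC ler_pdivrMr ?expR_gt0 //.
  apply: le_trans (PM x).
  by rewrite hornerM hornerD hornerC hornerXn normrM (ger0_norm (x := 1 + _)) // ltW.
have k0 x : 0 <= (oneDsqr x)^-1 by rewrite invr_ge0 (le_trans ler01) ?oneDsqr_ge1.
have mk : measurable_fun [set: R] (EFin \o (fun x : R => (oneDsqr x)^-1)).
  by apply/measurable_EFinP; apply: continuous_measurable_fun; exact: continuous_oneDsqrV.
apply: (@le_lt_trans _ _
    (\int[@lebesgue_measure R]_x (M%:E * ((oneDsqr x)^-1)%:E))%E).
  apply: ge0_le_integral => //.
  - by move=> x _; rewrite lee_fin poly_gauss_ge0.
  - by apply/measurable_EFinP; exact: measurable_poly_gauss.
  - exact: measurable_funeM.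
  - by move=> x _; rewrite -EFinM lee_fin.
rewrite ge0_integralZl_EFin //=.
by rewrite lte_mul_pinfty ?integral_oneDsqr_lty // lee_fin.
Qed.

End GaussianMoments.

(** * The states *)

Lemma poly_nonroot {R : realType} (P : {poly R}) : P != 0 -> exists x, P.[x] != 0.
Proof.
move=> P0; apply: contrapT => /forallNP rootP.
pose r : seq R := [seq k%:R | k <- iota 0 (size P)].
have rr : all (root P) r by apply/allP => x _; apply: contrapT => /negP; exact: rootP.
have ur : uniq r.
  by rewrite map_inj_uniq ?iota_uniq // => i j /eqP; rewrite eqr_nat => /eqP.
by have := max_poly_roots P0 rr ur; rewrite size_map size_iota ltnn.
Qed.

Section HermiteStates.
Local Open Scope complex_scope.
Variables (R : realType) (s : nat) (E : R).
Hypothesis s_gt0 : (0 < s)%N.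
Implicit Types (P : {poly R}) (p : 'rV[R]_4).

Let c := E / (2 * s%:R ^+ 2).

Definition wave T : R[i] := cos (s%:R * T) +i* sin (s%:R * T).

Definition amplitude P p : R :=
  P.[Num.sqrt s%:R * (p 0 iZ + c)]
  * expR (- (2^-1 * s%:R * (p 0 iZ + c) ^+ 2))
  * expR (- (4^-1 * s%:R * (p 0 iX ^+ 2 + p 0 iY ^+ 2))).

Lemma hermite_stateE P :
  hermite_state s E P = fun p => (amplitude P p)%:C * wave (p 0 iT).
Proof. by []. Qed.

Lemma has_pderiv_wave a p : has_pderiv a (fun q => wave (q 0 iT)) p
  ((s%:R * unitvec R a 0 iT)%:C * 'i * wave (p 0 iT)).
Proof.
have D : is_derive p (unitvec R a) (fun q : 'rV[R]_4 => s%:R * q 0 iT)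
    (s%:R * unitvec R a 0 iT).
  apply: is_derive_eq
    (is_derive_mul (is_derive_cst (s%:R : R) _ _) (is_derive_coord _ _ _)) _.
  by rewrite mul0r add0r.
split; rewrite /wave /=.
- by apply: is_derive_eq (is_derive_comp (is_derive_cos _) D) _; ring.
- by apply: is_derive_eq (is_derive_comp (is_derive_sin _) D) _; ring.
Qed.

(** Differentiating P(r zeta) exp(- s zeta^2 / 2), r the square root of s, along Z
    replaces P by r (P' - x P); so the amplitudes are stable under differentiation
    and the second derivative is obtained by applying the same rule twice. *)
Lemma is_derive_amplitude P p v : is_derive p v (amplitude P)
  (v 0 iZ * Num.sqrt s%:R * amplitude (P^`() - 'X * P) p
   - s%:R / 2 * (p 0 iX * v 0 iX + p 0 iY * v 0 iY) * amplitude P p).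
Proof.
have coord b := is_derive_coord p v b.
have cst k : is_derive p v (fun=> k : R) 0 := is_derive_cst k p v.
have Dz := is_derive_add (coord iZ) (cst c).
have DP := is_derive_comp (is_derive_poly P _) (is_derive_mul (cst (Num.sqrt s%:R)) Dz).
have DZ := is_derive_comp (is_derive_expR _)
  (is_derive_mul (cst (- (2^-1 * s%:R))) (is_derive_mul Dz Dz)).
have DXY := is_derive_comp (is_derive_expR _)
  (is_derive_mul (cst (- (4^-1 * s%:R))) (is_derive_add
     (is_derive_mul (coord iX) (coord iX)) (is_derive_mul (coord iY) (coord iY)))).
have := is_derive_mul (is_derive_mul DP DZ) DXY.
have -> : (fun q : 'rV[R]_4 => P.[Num.sqrt s%:R * (q 0 iZ + c)]
    * expR (- (2^-1 * s%:R) * ((q 0 iZ + c) * (q 0 iZ + c)))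
    * expR (- (4^-1 * s%:R) * (q 0 iX * q 0 iX + q 0 iY * q 0 iY))) = amplitude P.
  by apply/funext => q; rewrite /amplitude -!expr2 !mulNr.
move=> /is_derive_eq; apply.
rewrite /amplitude hornerD hornerN hornerM hornerX -!expr2 !mulNr.
set e1 := expR _; set e2 := expR _; set x := P.[_]; set x' := (P^`()).[_].
have ss : s%:R = Num.sqrt s%:R ^+ 2 :> R by rewrite sqr_sqrtr.
by move: ss; set r := Num.sqrt _ => ->; field.
Qed.

Lemma has_pderiv_state a P p : has_pderiv a (hermite_state s E P) p
  ((unitvec R a 0 iZ * Num.sqrt s%:R)%:C * hermite_state s E (P^`() - 'X * P) p
   + (- (s%:R / 2 * (p 0 iX * unitvec R a 0 iX + p 0 iY * unitvec R a 0 iY)))%:C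
     * hermite_state s E P p
   + (s%:R * unitvec R a 0 iT)%:C * 'i * hermite_state s E P p).
Proof.
have := has_pderiv_mul (has_pderiv_real (is_derive_amplitude P p (unitvec R a)))
  (has_pderiv_wave a p).
congr has_pderiv; rewrite !hermite_stateE rmorphB !rmorphM rmorphN !rmorphM /=; ring.
Qed.

Lemma pderiv_state P : [/\
  pderiv iT (hermite_state s E P) = fun q => s%:R%:C * 'i * hermite_state s E P q,
  pderiv iX (hermite_state s E P)
    = fun q => (- (s%:R / 2 * q 0 iX))%:C * hermite_state s E P q,
  pderiv iY (hermite_state s E P)
    = fun q => (- (s%:R / 2 * q 0 iY))%:C * hermite_state s E P q &
  pderiv iZ (hermite_state s E P)
    = fun q => (Num.sqrt s%:R)%:C * hermite_state s E (P^`() - 'X * P) q].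
Proof.
by split; apply/funext => q; rewrite (has_pderivE (has_pderiv_state _ P q))
  !mxE !eqxx !eq_dir /= !(mulr0, mul0r, mulr1, mul1r, addr0, add0r, oppr0).
Qed.

Lemma state_mul P Q p : hermite_state s E (P * Q) p =
  (P.[Num.sqrt s%:R * (p 0 iZ + c)])%:C * hermite_state s E Q p.
Proof. by rewrite !hermite_stateE /amplitude hornerM !rmorphM /= !mulrA. Qed.

Lemma smooth_state P : smooth (hermite_state s E P).
Proof.
have eT : elementary (fun q : 'rV[R]_4 => s%:R * q 0 iT).
  by apply: elementary_mul; [exact: elementary_const|exact: elementary_coord].
have eZ : elementary (fun q : 'rV[R]_4 => q 0 iZ + c).
  by apply: elementary_add; [exact: elementary_coord|exact: elementary_const].
have eA : elementary (amplitude P).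
  apply: elementary_mul; first apply: elementary_mul.
  - apply: elementary_horner; apply: elementary_mul => //; exact: elementary_const.
  - apply: elementary_exp.
    have -> : (fun q : 'rV[R]_4 => - (2^-1 * s%:R * (q 0 iZ + c) ^+ 2)) =
        fun q => - (2^-1 * s%:R) * ((q 0 iZ + c) * (q 0 iZ + c)).
      by apply/funext => q; rewrite mulNr.
    by do !apply: elementary_mul => //; exact: elementary_const.
  - apply: elementary_exp.
    have -> : (fun q : 'rV[R]_4 => - (4^-1 * s%:R * (q 0 iX ^+ 2 + q 0 iY ^+ 2))) =
        fun q => - (4^-1 * s%:R) * (q 0 iX * q 0 iX + q 0 iY * q 0 iY).
      by apply/funext => q; rewrite mulNr.
    apply: elementary_mul; first exact: elementary_const.
    by apply: elementary_add; apply: elementary_mul; exact: elementary_coord.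
move=> n; split; apply: elementary_Cn.
- have -> : (fun q => complex.Re (hermite_state s E P q)) =
      fun q => amplitude P q * cos (s%:R * q 0 iT).
    by apply/funext => q; rewrite hermite_stateE /= mul0r subr0.
  by apply: elementary_mul => //; exact: elementary_cos.
- have -> : (fun q => complex.Im (hermite_state s E P q)) =
      fun q => amplitude P q * sin (s%:R * q 0 iT).
    by apply/funext => q; rewrite hermite_stateE /= mul0r addr0.
  by apply: elementary_mul => //; exact: elementary_sin.
Qed.

(** Hermite's equation says exactly that two such steps multiply H by
    x^2 - 1 - 2 n: the Gaussian times H is an eigenfunction of the oscillator. *)
Lemma hermite_ladder n P : is_hermite n P ->
  (P^`() - 'X * P)^`() - 'X * (P^`() - 'X * P) = ('X^2 - (1 + 2 * n%:R)%:P) * P.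
Proof.
move=> [_ ode].
have -> : (P^`() - 'X * P)^`() - 'X * (P^`() - 'X * P) =
    (P^`()^`() - (2 *: 'X) * P^`() + (2 * n%:R) *: P)
    + ('X^2 - (1 + 2 * n%:R)%:P) * P.
  rewrite derivB derivM derivX -!mul_polyC !polyCD polyC1; ring.
by rewrite ode add0r.
Qed.

Lemma pderiv2_state P p : [/\
  pderiv iT (pderiv iT (hermite_state s E P)) p
    = (- s%:R ^+ 2)%:C * hermite_state s E P p,
  pderiv iX (pderiv iT (hermite_state s E P)) p
    = s%:R%:C * 'i * ((- (s%:R / 2 * p 0 iX))%:C * hermite_state s E P p) &
  pderiv iY (pderiv iT (hermite_state s E P)) p
    = s%:R%:C * 'i * ((- (s%:R / 2 * p 0 iY))%:C * hermite_state s E P p)] /\ [/\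
  pderiv iX (pderiv iX (hermite_state s E P)) p
    = ((s%:R / 2 * p 0 iX) ^+ 2 - s%:R / 2)%:C * hermite_state s E P p,
  pderiv iY (pderiv iY (hermite_state s E P)) p
    = ((s%:R / 2 * p 0 iY) ^+ 2 - s%:R / 2)%:C * hermite_state s E P p &
  pderiv iZ (pderiv iZ (hermite_state s E P)) p = s%:R%:C *
    hermite_state s E ((P^`() - 'X * P)^`() - 'X * (P^`() - 'X * P)) p].
Proof.
have sm := smooth_state P.
have [dT dX dY dZ] := pderiv_state P.
have Dk a b : is_derive p (unitvec R a) (fun q : 'rV[R]_4 => - (s%:R / 2 * q 0 b))
    (- (s%:R / 2 * unitvec R a 0 b)).
  have := is_derive_mul (is_derive_cst (- (s%:R / 2) : R) _ _)
    (is_derive_coord p (unitvec R a) b).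
  by rewrite mul0r add0r mulNr; congr is_derive; apply/funext => q; rewrite mulNr.
split; split.
- rewrite dT (pderiv_mulc _ _ _ sm) dT mulrA; congr (_ * _).
  by rewrite mulrACA -expr2 -expr2 sqr_i rmorphN rmorphXn mulrN1.
- by rewrite dT (pderiv_mulc _ _ _ sm) dX.
- by rewrite dT (pderiv_mulc _ _ _ sm) dY.
- rewrite dX (pderiv_mul (Dk iX iX) sm) dX mulrA -mulrDl -rmorphM -rmorphD.
  by congr (_%:C * _); rewrite !mxE !eqxx /=; ring.
- rewrite dY (pderiv_mul (Dk iY iY) sm) dY mulrA -mulrDl -rmorphM -rmorphD.
  by congr (_%:C * _); rewrite !mxE !eqxx /=; ring.
- rewrite dZ (pderiv_mulc _ _ _ (smooth_state _)).
  have [_ _ _ ->] := pderiv_state (P^`() - 'X * P).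
  by rewrite mulrA -rmorphM -expr2 sqr_sqrtr.
Qed.

Lemma pderivT_comm P p :
  pderiv iT (pderiv iX (hermite_state s E P)) p =
    pderiv iX (pderiv iT (hermite_state s E P)) p /\
  pderiv iT (pderiv iY (hermite_state s E P)) p =
    pderiv iY (pderiv iT (hermite_state s E P)) p.
Proof.
have [[_ -> ->] _] := pderiv2_state P p.
have sm := smooth_state P.
have [dT dX dY _] := pderiv_state P.
have Dk b : b != iT ->
    is_derive p (unitvec R iT) (fun q : 'rV[R]_4 => - (s%:R / 2 * q 0 b)) 0.
  move=> bT; apply: is_derive_invariant => h.
  by rewrite !mxE (negPf bT) andbF mulr0 add0r.
have XT : iX != iT by rewrite eq_dir.
have YT : iY != iT by rewrite eq_dir.
split.
- by rewrite dX (pderiv_mul (Dk iX XT) sm) dT mul0r add0r mulrCA.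
- by rewrite dY (pderiv_mul (Dk iY YT) sm) dT mul0r add0r mulrCA.
Qed.

(** Multiplied by Z, the equation splits. The two mixed terms cancel, since the state
    is invariant under rotations of the (X, Y)-plane. The Gaussian in (X, Y)
    absorbs s^2 (X^2 + Y^2) / 4 and leaves - s, and what remains is
    psi'' = (s^2 Z^2 + E Z + s) psi. Completing the square turns this into the
    oscillator equation centred at - E / (2 s^2); its right-hand side is the
    s (s zeta^2 - 1 - 2 n) psi of [hermite_ladder] when n + 1 = E^2 / (8 s^3). *)
Lemma state_eigen n H p : is_hermite n H ->
  n%:R = E ^+ 2 / (8 * s%:R ^+ 3) - 1 -> p 0 iZ != 0 ->
  expanded_operator (hermite_state s E H) p = E%:C * hermite_state s E H p.
Proof.
move=> Hn En Z0; rewrite /expanded_operator.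
have [[-> -> ->] [-> -> ->]] := pderiv2_state H p.
rewrite (hermite_ladder Hn) state_mul hornerD hornerN hornerC hornerXn.
rewrite [(Num.sqrt _ * _) ^+ 2]exprMn sqr_sqrtr // En /c.
have s0 : s%:R != 0 :> R by rewrite pnatr_eq0 -lt0n.
move: (hermite_state s E H p) (p 0 iX) (p 0 iY) (p 0 iZ) Z0 => [x y] X Y Z Z0.
move: (s%:R : R) s0 => r r0.
by apply/eqP; rewrite eq_complex /=; apply/andP; split; apply/eqP; field; apply/andP.
Qed.

Lemma state_periodic P : periodicT (hermite_state s E P).
Proof.
move=> p; rewrite !hermite_stateE /amplitude !mxE !eqxx !eq_dir /= !mulr0 !addr0 mulr1.
congr (_ * (_ +i* _)).
- have -> : s%:R * (p 0 iT + 2 * pi) = s%:R * p 0 iT + pi *+ 2 *+ s.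
    by rewrite -[_ *+ s]mulr_natl -[_ *+ 2]mulr_natl; ring.
  by rewrite (periodicn (@cosD2pi R)).
- have -> : s%:R * (p 0 iT + 2 * pi) = s%:R * p 0 iT + pi *+ 2 *+ s.
    by rewrite -[_ *+ s]mulr_natl -[_ *+ 2]mulr_natl; ring.
  by rewrite (periodicn (@sinD2pi R)).
Qed.

Lemma normc_state P p :
  ComplexField.Normc.normc (hermite_state s E P p) ^+ 2 = amplitude P p ^+ 2.
Proof.
rewrite hermite_stateE /= sqr_sqrtr ?addr_ge0 ?sqr_ge0 //.
have := cos2Dsin2 (s%:R * p 0 iT); set C := cos _; set S := sin _ => CS.
have -> : (amplitude P p * C - 0 * S) ^+ 2 + (amplitude P p * S + 0 * C) ^+ 2 =
  amplitude P p ^+ 2 * (C ^+ 2 + S ^+ 2) by ring.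
by rewrite CS mulr1.
Qed.

Lemma state_neq0 P : P != 0 -> exists p, hermite_state s E P p != 0.
Proof.
move=> /poly_nonroot [x Px].
have r0 : Num.sqrt s%:R != 0 :> R by rewrite gt_eqF // sqrtr_gt0 ltr0n.
exists (coords 0 0 0 ((Num.sqrt s%:R)^-1 * x - c)).
apply/eqP => /(congr1 (fun w => ComplexField.Normc.normc w ^+ 2)).
rewrite normc_state /= expr0n /= addr0 sqrtr0 expr0n /=; apply/eqP.
rewrite sqrf_eq0 /amplitude !mulf_neq0 ?(gt_eqF (expR_gt0 _)) //.
by rewrite coordsE subrK mulrA divff // mul1r.
Qed.

(** The squared modulus is independent of the phase, hence of T, and is a product of
    Gaussians in X and Y and of H(r zeta)^2 exp(- s zeta^2). The density |Z|
    fits into the last factor: it makes H(r zeta)^2 |Z| the absolute value of a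
    polynomial in Z. *)
Lemma state_normalisable P : normalisable (hermite_state s E P).
Proof.
have s0 : 0 < s%:R :> R by rewrite ltr0n.
pose Q := (P \Po (Num.sqrt s%:R *: ('X + c%:P))) ^+ 2 * 'X.
pose k := poly_gauss (1 : {poly R}) (s%:R / 2) 0.
have kI : (\int[@lebesgue_measure R]_x (k x)%:E < +oo)%E.
  by apply: integral_poly_gauss_lty; rewrite divr_gt0.
have QI := integral_poly_gauss_lty Q c s0.
have mk := measurable_poly_gauss (1 : {poly R}) (s%:R / 2) 0.
have mQ := measurable_poly_gauss Q s%:R c.
have k0 := poly_gauss_ge0 (1 : {poly R}) (s%:R / 2) 0.
have Q0 := poly_gauss_ge0 Q s%:R c.
have := spacetime_integral_lty (2 * pi) mk mk mQ k0 k0 Q0 kI kI QI.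
rewrite /normalisable; congr (integral _ _ _ < _)%E.
apply/funext => -[[[t x] y] z] /=; congr EFin.
rewrite normc_state /amplitude !coordsE /poly_gauss /Q.
rewrite !hornerC !normr1 !mul1r !addr0 hornerM horner_exp horner_comp hornerX.
rewrite hornerZ hornerD hornerX hornerC normrM (ger0_norm (sqr_ge0 _)).
rewrite !exprMn -!expRM_natl.
have -> : 2%:R * - (4^-1 * s%:R * (x ^+ 2 + y ^+ 2)) =
  - (s%:R / 2 * x ^+ 2) + - (s%:R / 2 * y ^+ 2) by field.
have -> : 2%:R * - (2^-1 * s%:R * (z + c) ^+ 2) = - (s%:R * (z + c) ^+ 2) by field.
rewrite expRD; ring.
Qed.

End HermiteStates.

Theorem mainTheorem3 (R : realType) :
  (exists (E : R) (phi : 'rV[R]_4 -> R[i]),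
     normalisable_solution_through_fold E phi) /\
  (forall (s : nat) (E : R) (gamma : nat) (H : {poly R}),
     (0 < s)%N -> (0 < gamma)%N ->
     gamma%:R = E ^+ 2 / (8 * s%:R ^+ 3) - 1 ->
     is_hermite gamma H ->
     normalisable_solution_through_fold E (hermite_state s E H)).
Proof.
have states (s : nat) (E : R) (gamma : nat) (H : {poly R}) :
    (0 < s)%N -> (0 < gamma)%N -> gamma%:R = E ^+ 2 / (8 * s%:R ^+ 3) - 1 ->
    is_hermite gamma H -> normalisable_solution_through_fold E (hermite_state s E H).
  move=> s0 _ Eg Hg.
  have sm := @smooth_state R s E H.
  have eigen (p : 'rV[R]_4) (Z0 : p 0 iZ != 0) := state_eigen s0 Hg Eg Z0.
  have H0 : H != 0 by rewrite -size_poly_eq0 Hg.1.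
  split.
  - exact: state_periodic.
  - exact: state_neq0.
  - move=> p Z0; have [TX TY] := pderivT_comm s E H p.
    by rewrite (laplace_beltrami_expanded sm Z0 TX TY); exact: eigen.
  - by split.
  - exact: state_normalisable.
split=> //.
(* The smallest case: s = gamma = 1 forces E^2 = 16. *)
exists 4, (hermite_state 1 4 (physicists_hermite R 1)).
apply: (states 1%N 4 1%N) => //; last exact: is_hermite_physicists.
by field.
Qed.
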